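(* Let $D$ be a strong semicomplete digraph, and let $x$ and $y$ be two distinct vertices of $D$. If there are two arc-disjoint $(x,y)$-paths in $D$, then there is a spanning $(x,y)$-trail in $D\setminus\{yx\}$.
   Context: Digraphs are finite, with no loops and no parallel arcs (two opposite arcs $xy$, $yx$ are allowed). A digraph is semicomplete if it has no pair of non-adjacent vertices. A digraph is strong if it contains an $(s,t)$-path for each ordered pair of distinct vertices $s,t$. Paths and trails are directed. A trail is a walk in which all arcs are distinct (vertices may repeat); a path is a walk in which all vertices are distinct. An $(x,y)$-trail (resp. $(x,y)$-path) has initial vertex $x$ and terminal vertex $y$. A trail is spanning if it visits every vertex of $D$. $D\setminus\{yx\}$ is the digraph obtained from $D$ by deleting the arc $yx$ if it exists (and is $D$ itself if $yx$ is not an arc of $D$). *)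

(* Defs.v *)
From mathcomp Require Import all_boot.

Set Implicit Arguments.
Unset Strict Implicit.
Unset Printing Implicit Defensive.

(* A digraph is an irreflexive relation D on a finType V, with D u v meaning
   that uv is an arc; a relation cannot encode parallel arcs.
   A walk with vertices x, p_1, ..., p_k is given by its initial vertex x and
   the sequence p of the remaining ones, as in the path library; with no
   parallel arcs, the vertices of a walk determine its arcs. *)

Section Digraph.

Variables (V : finType) (D : rel V).

Definition semicomplete := forall u v : V, u != v -> D u v || D v u.

Definition walk_arcs (x : V) (p : seq V) : seq (V * V) := pairmap pair x p.

Definition is_walk (x y : V) (p : seq V) := path D x p && (last x p == y).

Definition is_path (x y : V) (p : seq V) := is_walk x y p && uniq (x :: p).

Definition is_trail (x y : V) (p : seq V) :=
  is_walk x y p && uniq (walk_arcs x p).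

Definition strong := forall s t : V, s != t -> exists p, is_path s t p.

Definition spanning (x : V) (p : seq V) := forall v : V, v \in x :: p.

(* Both walks start at x. *)
Definition arc_disjoint (x : V) (p q : seq V) :=
  [disjoint walk_arcs x p & walk_arcs x q].

Definition del_arc (a b : V) : rel V :=
  [rel u v | D u v && ((u, v) != (a, b))].

End Digraph.

(* Main.v *)
Require Import Defs.
From mathcomp Require Import all_boot.

Set Implicit Arguments.
Unset Strict Implicit.
Unset Printing Implicit Defensive.

(** Take an (x,y)-trail T in D \ yx whose vertex set is maximal, and suppose
    that the set R of vertices missed by T is nonempty.  By maximality no
    vertex of R can be inserted on an arc of T, and no closed detour through R
    can be attached at a vertex of T.  Hence between t in T and v in R there is
    exactly one arc, and along T the relation "t dominates v" is preserved.
    So the set L of the vertices of T dominated by all of R is an initial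
    segment of T, left only once by T, and strength gives x in L and y not in
    L.  An arc uw that leaves L and is not traversed by T would give a closed
    detour u w v u, where v in R does not dominate w.  Thus a single
    arc of D leaves L, and it lies on every (x,y)-path. *)

(** * Walks and their arcs *)

Lemma walk_arcs_cat (V : finType) (x : V) (p q : seq V) :
  walk_arcs x (p ++ q) = walk_arcs x p ++ walk_arcs (last x p) q.
Proof. exact: pairmap_cat. Qed.

Lemma walk_arcs_vertices (V : finType) (x a b : V) (p : seq V) :
  (a, b) \in walk_arcs x p -> (a \in x :: p) && (b \in x :: p).
Proof.
elim: p x => [|z p IHp] x //=; rewrite in_cons => /orP[/eqP[-> ->]|/IHp].
  by rewrite !in_cons !eqxx !orbT.
by rewrite (in_cons x) (in_cons x (z :: p) b) => /andP[-> ->]; rewrite !orbT.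
Qed.

Lemma walk_arcs_split (V : finType) (x a b : V) (p : seq V) :
  (a, b) \in walk_arcs x p ->
  exists p1 p2, p = p1 ++ b :: p2 /\ last x p1 = a.
Proof.
elim: p x => [|z p IHp] x //=; rewrite in_cons => /orP[/eqP[-> ->]|/IHp].
  by exists [::], p.
by move=> [p1 [p2 [-> <-]]]; exists (z :: p1), p2.
Qed.

(** The heads of the arcs, read in order, are exactly [p]; hence [x] itself may recur in [p]. *)
Lemma walk_arcs_uniq (V : finType) (x : V) (p : seq V) :
  uniq p -> uniq (walk_arcs x p).
Proof.
move=> Up; apply: (@map_uniq _ _ snd); suff -> : map snd (walk_arcs x p) = p by [].
by elim: p x {Up} => //= z p IHp x; rewrite IHp.
Qed.

Lemma del_arc_path (V : finType) (D : rel V) (a b x : V) (p : seq V) :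
  b \notin p -> path D x p -> path (del_arc D a b) x p.
Proof.
elim: p x => //= z p IHp x; rewrite in_cons negb_or => /andP[bz bp] /andP[Dxz Dp].
by rewrite IHp // /del_arc /= Dxz xpair_eqE negb_and (eq_sym z) bz orbT.
Qed.

Lemma walk_invariant (V : finType) (P : pred V) (x : V) (p : seq V) :
  (forall a b, (a, b) \in walk_arcs x p -> P a -> P b) ->
  P x -> {in x :: p, forall v, P v}.
Proof.
elim: p x => [|z p IHp] x /= Pab Px v; first by rewrite inE => /eqP->.
rewrite in_cons => /orP[/eqP->//|]; apply: IHp => [a b abp|].
  by apply: Pab; rewrite in_cons abp orbT.
by apply: Pab Px; rewrite in_cons eqxx.
Qed.

Lemma walk_invariant_rev (V : finType) (P : pred V) (x : V) (p : seq V) :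
  (forall a b, (a, b) \in walk_arcs x p -> P b -> P a) ->
  P (last x p) -> {in x :: p, forall v, P v}.
Proof.
elim: p x => [|z p IHp] x /= Pba Pl v; first by rewrite inE => /eqP->.
have Pzp : {in z :: p, forall v, P v}.
  by apply: IHp => // a b abp; apply: Pba; rewrite in_cons abp orbT.
rewrite in_cons => /orP[/eqP->|/Pzp//].
by apply: (Pba _ z); rewrite ?in_cons ?eqxx // Pzp // mem_head.
Qed.

Lemma walk_crossing (V : finType) (D : rel V) (P : pred V) (x : V) (p : seq V) :
  path D x p -> P x -> ~~ P (last x p) ->
  exists a b, [/\ (a, b) \in walk_arcs x p, D a b, P a & ~~ P b].
Proof.
elim: p x => [|z p IHp] x /=; first by move=> _ ->.
move=> /andP[Dxz Dp] Px Pl; have [Pz|Pz] := boolP (P z); last first.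
  by exists x, z; rewrite in_cons eqxx.
have [a [b [abp Dab Pa Pb]]] := IHp z Dp Pz Pl.
by exists a, b; rewrite in_cons abp orbT.
Qed.

(** Read contrapositively, the first hypothesis says that a walk outside [P] stays outside, so there
    is no second exit. *)
Lemma walk_crossing_unique (V : finType) (P : pred V) (x : V) (p : seq V)
    (a b c d : V) :
  (forall a b, (a, b) \in walk_arcs x p -> P b -> P a) ->
  (a, b) \in walk_arcs x p -> P a -> ~~ P b ->
  (c, d) \in walk_arcs x p -> P c -> ~~ P d -> (a, b) = (c, d).
Proof.
elim: p x => [|z p IHp] x //= Pba.
have Pba' a' b' : (a', b') \in walk_arcs z p -> P b' -> P a'.
  by move=> abp; apply: Pba; rewrite in_cons abp orbT.
have stuck a' b' : (a', b') \in walk_arcs z p -> P a' -> ~~ P z -> False.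
  move=> /walk_arcs_vertices/andP[a'p _] Pa' nPz.
  have nP : {in z :: p, forall v, ~~ P v}.
    by apply: walk_invariant => // u v /Pba' Puv; apply: contra.
  by have:= nP _ a'p; rewrite Pa'.
rewrite !in_cons => /orP[/eqP[-> ->]|abp] Pa nPb /orP[/eqP[-> ->]|cdp] Pc nPd //.
- by case: (stuck _ _ cdp Pc nPb).
- by case: (stuck _ _ abp Pa nPd).
- exact: IHp Pba' abp Pa nPb cdp Pc nPd.
Qed.

(** * Surgery on trails *)

Lemma trail_size (V : finType) (D : rel V) (x y : V) (p : seq V) :
  is_trail D x y p -> size p <= #|{: V * V}|.
Proof.
move=> /andP[_ /card_uniqP up]; rewrite -(size_pairmap pair x p) -up.
exact: max_card.
Qed.

Lemma trail_detour (V : finType) (E : rel V) (x y u : V) (p1 p2 c : seq V) :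
  is_trail E x y (p1 ++ p2) -> last x p1 = u ->
  path E u c -> last u c = u -> uniq (walk_arcs u c) ->
  [disjoint walk_arcs u c & walk_arcs x (p1 ++ p2)] ->
  is_trail E x y (p1 ++ c ++ p2).
Proof.
rewrite /is_trail /is_walk !walk_arcs_cat !cat_path !last_cat.
move=> /andP[/andP[/andP[-> E2] l2] U] <- Ec lc Uc cp; rewrite lc Ec E2 l2 /=.
rewrite disjoint_sym disjoint_has in cp.
by rewrite uniq_catCA cat_uniq U Uc andbT.
Qed.

(** Both new arcs are incident to [v], which is off the trail, so neither was used before; they
    differ from each other since [last x p1] is not [v]. *)
Lemma trail_insert (V : finType) (E : rel V) (x y v w : V) (p1 p2 : seq V) :
  is_trail E x y (p1 ++ w :: p2) -> v \notin x :: p1 ++ w :: p2 ->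
  E (last x p1) v -> E v w -> is_trail E x y (p1 ++ v :: w :: p2).
Proof.
move=> tr nv Euv Evw; move: tr.
have nvs a b : (a == v) || (b == v) -> (a, b) \notin walk_arcs x (p1 ++ w :: p2).
  move=> abv; apply: contraNN nv => /walk_arcs_vertices/andP[ap bp].
  by case/orP: abv => /eqP <-.
have := nvs v w; have := nvs (last x p1) v.
rewrite !eqxx orbT => /(_ isT) uvT /(_ isT) vwT.
have uv : last x p1 != v.
  by apply: contraNneq nv => <-; rewrite -cat_cons mem_cat mem_last.
move: uvT vwT; rewrite /is_trail /is_walk !walk_arcs_cat !cat_path !last_cat /=.
rewrite Euv Evw !mem_cat !in_cons !negb_or.
move=> /and3P[uv1 _ uv2] /and3P[vw1 _ vw2] /andP[/andP[/and3P[-> _ ->] ->]] /=.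
rewrite !(uniq_catC (walk_arcs x p1)) /= !mem_cat !in_cons !negb_or.
by rewrite xpair_eqE (negPf uv) mem_cat negb_or uv1 uv2 vw1 vw2 => /andP[_ ->].
Qed.

(** * Trails with a maximal vertex set *)

Definition maximal_trail (V : finType) (E : rel V) (x y : V) (t : seq V) :=
  is_trail E x y t /\
  forall t', is_trail E x y t' -> {subset x :: t <= x :: t'} ->
             {subset x :: t' <= x :: t}.

(** By [trail_size] all trails live in a finite type of bounded sequences; one with the most
    distinct vertices is maximal for inclusion. *)
Lemma maximal_trail_exists (V : finType) (E : rel V) (x y : V) (t : seq V) :
  is_trail E x y t -> exists t', maximal_trail E x y t'.
Proof.
move=> tr.
pose b0 : {bseq #|{: V * V}| of V} := Bseq (trail_size tr).
have trb0 : is_trail E x y b0 by [].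
pose P (b : {bseq #|{: V * V}| of V}) := is_trail E x y b.
case: (@arg_maxnP _ b0 P (fun b => #|x :: b|) trb0) => b trb bmax.
exists b; split=> // t' trt' bt'.
have := bmax (Bseq (trail_size trt')) trt'; rewrite /= => le_t'b.
have sub : x :: b \subset x :: t' by apply/subsetP.
by have /geq_leqif := subset_leqif_card sub; rewrite le_t'b => /esym/subsetP.
Qed.

Lemma maximal_trail_detour (V : finType) (E : rel V) (x y u : V) (t c : seq V) :
  maximal_trail E x y t ->
  u \in x :: t -> path E u c -> last u c = u -> uniq (walk_arcs u c) ->
  [disjoint walk_arcs u c & walk_arcs x t] -> {subset c <= x :: t}.
Proof.
move=> + ut; case/splitPl: ut => p1 p2 lp1 [tr tmax] Ec lc Uc ct z zc.
apply: (tmax _ (trail_detour tr lp1 Ec lc Uc ct)).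
  by move=> z'; rewrite !in_cons !mem_cat => /or3P[]->; rewrite ?orbT.
by rewrite in_cons !mem_cat zc !orbT.
Qed.

Lemma maximal_trail_insert (V : finType) (E : rel V) (x y u v w : V) (t : seq V) :
  maximal_trail E x y t ->
  (u, w) \in walk_arcs x t -> v \notin x :: t -> E u v -> ~~ E v w.
Proof.
case=> tr tmax /walk_arcs_split[p1 [p2 [tE <-]]] nv Euv.
apply/negP => Evw; move: (nv); rewrite tE in tr tmax nv *.
move/(trail_insert tr)/(_ Euv Evw) => /tmax tmax'.
move/negP: nv; apply; apply: tmax' => [z|].
  by rewrite !in_cons !mem_cat !in_cons => /or4P[]->; rewrite ?orbT.
by rewrite in_cons mem_cat mem_head !orbT.
Qed.

Theorem theorem11 (V : finType) (D : rel V) (x y : V) :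
  irreflexive D -> strong D -> semicomplete D -> x != y ->
  (exists p q : seq V,
     [/\ is_path D x y p, is_path D x y q & arc_disjoint x p q]) ->
  exists t : seq V, is_trail (del_arc D y x) x y t /\ spanning x t.
Proof.
move=> irrD strD scD xy [p [q [Pp Pq pq]]].
have [t0 tr0] : exists t0, is_trail (del_arc D y x) x y t0.
  (* A path starting at [x] never re-enters [x], so it avoids the arc [yx]. *)
  exists p; move: Pp => /andP[/andP[Dp lp] /andP[xp Up]].
  by rewrite /is_trail /is_walk lp walk_arcs_uniq // del_arc_path.
have [t maxt] := maximal_trail_exists tr0; exists t.
case: (maxt) => tr _; split=> //.
have yT : y \in x :: t by case/andP: tr => /andP[_ /eqP<-] _; apply: mem_last.
have lastt : last x t = y by case/andP: tr => /andP[_ /eqP].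
have xT : x \in x :: t by apply: mem_head.
have [/forallP // | /forallPn[r rT]] := boolP [forall v, v \in x :: t].
set E := del_arc D y x in tr maxt.
(* The deleted arc has both ends on [t], so [E] and [D] agree on arcs with an end off [t]. *)
have Eout u v : v \notin x :: t -> E u v = D u v.
  move=> vT; rewrite /E /del_arc /= xpair_eqE.
  by rewrite (_ : v == x = false) ?andbF ?andbT //; apply: contraNF vT => /eqP->.
have Ein u v : v \notin x :: t -> E v u = D v u.
  move=> vT; rewrite /E /del_arc /= xpair_eqE.
  by rewrite (_ : v == y = false) ?andbT //; apply: contraNF vT => /eqP->.
have neqT u v : u \in x :: t -> v \notin x :: t ->
    (u == v = false) * (v == u = false).
  move=> uT vT; have nuv : u == v = false by apply: contraNF vT => /eqP<-.
  by split; last rewrite eq_sym.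
have outT a b : (a \notin x :: t) || (b \notin x :: t) ->
    (a, b) \notin walk_arcs x t.
  by rewrite -negb_and; apply: contraNN => /walk_arcs_vertices.
(* Two opposite arcs would form the closed detour [u v u]. *)
have oneway u v : u \in x :: t -> v \notin x :: t -> D v u = ~~ D u v.
  move=> uT vT; have := scD u v; rewrite (neqT u v) // => /(_ isT).
  case Duv: (D u v); case Dvu: (D v u) => //= _.
  have := maximal_trail_detour maxt uT (c := [:: v; u]).
  rewrite /= Eout // Ein // Duv Dvu /= !in_cons xpair_eqE (neqT u v) //.
  rewrite !disjoint_cons !outT ?vT ?orbT // disjoint0 /= => H.
  by have := H isT erefl isT isT v (mem_head _ _); rewrite (negPf vT).
have fwd v : v \notin x :: t ->
    forall a b, (a, b) \in walk_arcs x t -> D a v -> D b v.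
  move=> vT a b abT Dav; have := maximal_trail_insert maxt abT vT.
  have /andP[_ bT] := walk_arcs_vertices abT.
  by rewrite Eout // Ein // (oneway b) // negbK; apply.
have detour2 u v w : u \in x :: t -> v \notin x :: t -> w \notin x :: t ->
    D u v -> D v w -> ~~ D w u.
  move=> uT vT wT Duv Dvw; apply/negP => Dwu.
  have nvw : v == w = false by apply: contraTF Dvw => /eqP->; rewrite irrD.
  have := maximal_trail_detour maxt uT (c := [:: v; w; u]).
  rewrite /= (Eout u v) // (Eout v w) // (Ein u w) // Duv Dvw Dwu /=.
  rewrite !in_cons !xpair_eqE nvw.
  rewrite !(neqT u v) // !(neqT u w) //= ?andbF.
  rewrite !disjoint_cons !outT ?vT ?wT ?orbT // disjoint0 /= => H.
  by have := H isT erefl isT isT v (mem_head _ _); rewrite (negPf vT).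
pose L := [pred u | (u \in x :: t) && [forall v, (v \notin x :: t) ==> D v u]].
(* If [x] dominates some [v] off [t], a path from [v] to [y] leaves the set [Z] of such vertices by
   an arc [ab]. By [fwd] all of [t] dominates [a], so [b] is off [t]; not being dominated by [x], it
   dominates [x], and [x a b x] is a closed detour. *)
have xL : L x.
  rewrite /= xT; apply/forallP => v; apply/implyP => vT.
  rewrite oneway //; apply/negP => Dxv.
  pose Z := [pred z | (z \notin x :: t) && D x z].
  have nvy : v != y by rewrite (neqT y v).
  have [s /andP[/andP[Ds /eqP ls] _]] := strD v y nvy.
  have Zv : Z v by rewrite /= vT.
  have [|a [b [_ Dab /andP[aT Dxa]]]] := walk_crossing Ds Zv.
    by rewrite ls /= yT.
  rewrite negb_and negbK; have [bT _|bT] := boolP (b \in x :: t).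
    have := walk_invariant (fwd a aT) Dxa bT.
    by apply/negP; rewrite -oneway.
  by rewrite /= -oneway // (negPf (detour2 _ _ _ xT aT bT Dxa Dab)).
(* A path from [x] to [r] leaves [t] by an arc [ab]. If [b] dominated [y], then by [fwd] read
   backwards it would dominate all of [t], including [a]. *)
have yL : ~~ L y.
  apply/negP => /andP[_ /forallP Ly].
  have nxr : x != r by rewrite (neqT x r).
  have [s /andP[/andP[Ds /eqP ls] _]] := strD x r nxr.
  have [|a [b [_ Dab aT bT]]] := walk_crossing (P := mem (x :: t)) Ds xT.
    by rewrite ls.
  have := @walk_invariant_rev _ (fun u => D b u) x t.
  rewrite lastt (implyP (Ly b) bT) => H.
  suff : D b a by rewrite oneway // Dab.
  apply: H aT => // u w uwT; have /andP[uT wT] := walk_arcs_vertices uwT.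
  by rewrite (oneway u) // (oneway w) //; apply: contra; apply: fwd uwT.
have exitL u w : D u w -> L u -> ~~ L w -> (u, w) \in walk_arcs x t.
  move=> Duw /andP[uT /forallP Lu]; rewrite negb_and.
  (* Off [t], [w] would dominate [u], as [u] is in [L]. *)
  have [wT /=|wT _] := boolP (w \in x :: t); last first.
    by have := implyP (Lu w) wT; rewrite oneway // Duw.
  move=> /forallPn[v]; rewrite negb_imply => /andP[vT nDvw].
  have Dvu := implyP (Lu v) vT.
  have Dwv : D w v by move: nDvw; rewrite oneway // negbK.
  apply/idPn => uwT.
  have nuw : u == w = false by apply: contraTF Duw => /eqP->; rewrite irrD.
  (* The arc [uw] is not the deleted one, since [u] is in [L] and [y] is not. *)
  have Euw : E u w.
    rewrite /E /del_arc /= Duw xpair_eqE negb_and; apply/orP; left.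
    by apply: contraNneq yL => <-; rewrite /= uT; apply/forallP.
  have := maximal_trail_detour maxt uT (c := [:: w; v; u]).
  rewrite /= Euw (Eout w v) // (Ein u v) // Dwv Dvu /= !in_cons !xpair_eqE nuw.
  rewrite !(neqT u v) // !(neqT w v) //= ?andbF.
  rewrite !disjoint_cons uwT !outT ?vT ?orbT // disjoint0 /= => H.
  by have := H isT erefl isT isT v; rewrite (negPf vT) !in_cons eqxx orbT => /(_ isT).
have Lback a b : (a, b) \in walk_arcs x t -> L b -> L a.
  move=> abT /andP[bT /forallP Lb]; have /andP[aT _] := walk_arcs_vertices abT.
  rewrite /= aT; apply/forallP => v; apply/implyP => vT; move: (implyP (Lb v) vT).
  by rewrite (oneway a) // (oneway b) //; apply: contra; apply: fwd abT.
(* Every [(x,y)]-path must leave [L], and by [exitL] it does so along an arc of [t]; as [t] leaves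
   [L] only once, [p] and [q] share that arc. *)
have exit s : is_path D x y s ->
    exists a b,
      [/\ (a, b) \in walk_arcs x s, (a, b) \in walk_arcs x t, L a & ~~ L b].
  move=> /andP[/andP[Ds /eqP ls] _].
  have [|a [b [abs Dab La Lb]]] := walk_crossing Ds xL; first by rewrite ls.
  by exists a, b; split=> //; apply: exitL.
have [a [b [abp abT La Lb]]] := exit p Pp.
have [c [d [cdq cdT Lc Ld]]] := exit q Pq.
have := walk_crossing_unique Lback abT La Lb cdT Lc Ld => abcd.
by have := disjointFr pq abp; rewrite abcd cdq.
Qed.
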